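(* For every instance of $P2,S1|s_j,t_j|C_{max}$ with jobs $J_1,\dots,J_n$, the quantity $$LB_2=\sum_{j=1}^{n}(A_j-p_j)$$ is a valid lower bound for the problem, i.e. every feasible schedule has makespan $C_{max}\ge LB_2$.
   Context: Problem $P2,S1|s_j,t_j|C_{max}$: there are $n$ independent jobs $J_1,\dots,J_n$, all available at time $0$, each with loading time $s_j>0$, integer processing time $p_j>0$ and unloading time $t_j>0$; two identical parallel machines; and one server. Each job is assigned to one machine, where it is loaded by the server, then processed, then unloaded by the server, with no delay between loading and processing nor between processing and unloading. A machine handles at most one job at a time and is occupied throughout loading, processing and unloading; the server performs at most one loading or unloading operation at a time. No preemption. The objective is to minimize the makespan $C_{max}$ (the largest time at which the unloading of a job ends). $A_j=s_j+p_j+t_j$ is the length of job $J_j$. *)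

(* Defs.v *)
From mathcomp Require Import all_boot all_order all_algebra.

Set Implicit Arguments.
Unset Strict Implicit.
Unset Printing Implicit Defensive.

Import Order.TTheory GRing.Theory Num.Theory.
Local Open Scope ring_scope.

(* Times are elements of an arbitrary totally ordered field R, which
   includes the real numbers. *)

Record instance (R : realFieldType) (n : nat) := Instance {
  load : 'I_n -> R;
  proc : 'I_n -> nat;
  unload : 'I_n -> R;
  load_gt0 : forall j, 0 < load j;
  proc_gt0 : forall j, (0 < proc j)%N;
  unload_gt0 : forall j, 0 < unload j
}.

Definition job_length (R : realFieldType) (n : nat) (I : instance R n)
    (j : 'I_n) : R :=
  load I j + (proc I j)%:R + unload I j.

Record schedule (R : realFieldType) (n : nat) := Schedule {
  machine : 'I_n -> 'I_2;
  load_start : 'I_n -> R;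
  proc_start : 'I_n -> R;
  unload_start : 'I_n -> R
}.

(* A server operation is a pair (j, b): the loading of job j if b = false, its
   unloading if b = true. *)
Definition server_op (n : nat) : Type := ('I_n * bool)%type.

Section Feasibility.

Variables (R : realFieldType) (n : nat) (I : instance R n) (S : schedule R n).

Definition completion (j : 'I_n) : R := unload_start S j + unload I j.

(* Activities occupy half-open time intervals, so that one may start at the
   very moment another one ends. *)
Definition occupies_machine (j : 'I_n) (x : R) : bool :=
  load_start S j <= x < completion j.

Definition occupies_server (o : server_op n) (x : R) : bool :=
  if o.2 then unload_start S o.1 <= x < unload_start S o.1 + unload I o.1
  else load_start S o.1 <= x < load_start S o.1 + load I o.1.

Record feasible : Prop := Feasible {
  load_start_ge0 : forall j, 0 <= load_start S j;
  no_wait_proc : forall j, proc_start S j = load_start S j + load I j;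
  no_wait_unload : forall j, unload_start S j = proc_start S j + (proc I j)%:R;
  machine_capacity : forall (x : R) (j k : 'I_n),
    machine S j = machine S k ->
    occupies_machine j x -> occupies_machine k x -> j = k;
  server_capacity : forall (x : R) (o o' : server_op n),
    occupies_server o x -> occupies_server o' x -> o = o'
}.

(* Completion times of a feasible schedule are positive, so the default value
   0 only matters when there are no jobs. *)
Definition makespan : R := \big[Num.max/0]_(j < n) completion j.

End Feasibility.

Definition valid_lower_bound (R : realFieldType) (n : nat) (I : instance R n)
    (b : R) : Prop :=
  forall S : schedule R n, feasible I S -> b <= makespan I S.

Definition LB2 (R : realFieldType) (n : nat) (I : instance R n) : R :=
  \sum_(j < n) (job_length I j - (proc I j)%:R).

(* Main.v *)
Require Import Defs.
From mathcomp Require Import all_boot all_order all_algebra.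
From mathcomp Require Import lra.

(** The single server carries out all [2 n] loading and unloading operations,
    and these occupy pairwise disjoint intervals lying between time [0] and the
    makespan. Disjoint intervals inside a window have total length at most the
    length of the window ([sum_disjoint_intervals_le]), and the total length of
    the server operations is exactly [LB2]. That the window
    contains every operation follows from the order of the stages of each job:
    its unloading starts after its loading and ends at its completion time. *)

Set Implicit Arguments.
Unset Strict Implicit.
Unset Printing Implicit Defensive.

Import Order.TTheory GRing.Theory Num.Theory.
Local Open Scope ring_scope.

(** Induction on the number of intervals, removing the one that starts last:
    its left endpoint [start k] lies in no other interval, so all the others
    end by [start k] and fit in the shorter window from [lo] to [start k]. *)
Lemma sum_disjoint_intervals_le (R : realDomainType) (T : finType)
    (start len : T -> R) (A : {set T}) (lo hi : R) :
    lo <= hi ->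
    {in A, forall i, 0 < len i} ->
    {in A, forall i, lo <= start i /\ start i + len i <= hi} ->
    {in A &, forall i j x, start i <= x < start i + len i ->
       start j <= x < start j + len j -> i = j} ->
  \sum_(i in A) len i <= hi - lo.
Proof.
elim: {A}_.+1 {-2}A (ltnSn #|A|) hi => // m IHm A ltAm hi lo_hi len_gt0 win dis.
have [->|[i0 Ai0]] := set_0Vmem A; first by rewrite big_set0 subr_ge0.
case: (@arg_maxP _ R T i0 [in A] start Ai0) => k Ak start_le.
have [lo_k k_hi] := win k Ak.
have sub i : i \in A :\ k -> i != k /\ i \in A by case/setD1P.
have rest : \sum_(i in A :\ k) len i <= start k - lo.
  apply: IHm => //.
  - by move: ltAm; rewrite (cardsD1 k A) Ak.
  - by move=> i /sub[_ /len_gt0].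
  - move=> i /sub[neq_ik Ai]; have [lo_i _] := win i Ai; split=> //.
    rewrite leNgt; apply/negP => k_in_i.
    case/eqP: neq_ik; apply: (dis i k Ai Ak (start k)).
      by rewrite k_in_i andbT; apply: start_le.
    by rewrite lexx ltrDl len_gt0.
  - by move=> i j /sub[_ Ai] /sub[_ Aj]; apply: dis.
rewrite (big_setD1 k Ak) /=; lra.
Qed.

Section ServerOperations.

Variables (R : realFieldType) (n : nat) (I : instance R n) (S : schedule R n).

Definition op_start (o : server_op n) : R :=
  if o.2 then unload_start S o.1 else load_start S o.1.

Definition op_length (o : server_op n) : R :=
  if o.2 then unload I o.1 else load I o.1.

Lemma occupies_serverE (o : server_op n) (x : R) :
  occupies_server I S o x = (op_start o <= x < op_start o + op_length o).
Proof. by case: o => j []. Qed.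

Lemma op_length_gt0 (o : server_op n) : 0 < op_length o.
Proof. by case: o => j []; [apply: unload_gt0 | apply: load_gt0]. Qed.

Lemma sum_op_length : \sum_o op_length o = LB2 I.
Proof.
rewrite -(pair_bigA _ (fun j b => op_length (j, b))) /=.
apply: eq_bigr => j _; rewrite big_bool /op_length /job_length /=; lra.
Qed.

Lemma op_start_ge0 (o : server_op n) : feasible I S -> 0 <= op_start o.
Proof.
case: o => j b feas; have := load_start_ge0 feas j.
have := load_gt0 I j; have := ler0n R (proc I j).
case: b; rewrite /op_start /= ?(no_wait_unload feas) ?(no_wait_proc feas); lra.
Qed.

Lemma op_end_le_makespan (o : server_op n) :
  feasible I S -> op_start o + op_length o <= makespan I S.
Proof.
case: o => j b feas.
apply: (@le_trans _ _ (completion I S j)); last exact: le_bigmax.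
have := unload_gt0 I j; have := ler0n R (proc I j).
rewrite /completion /op_start /op_length.
case: b => //=; rewrite (no_wait_unload feas) (no_wait_proc feas); lra.
Qed.

End ServerOperations.

Theorem proposition9 (R : realFieldType) (n : nat) (I : instance R n) :
  valid_lower_bound I (LB2 I).
Proof.
move=> S feas; rewrite -sum_op_length -[makespan I S]subr0.
rewrite (eq_bigl [in [set: server_op n]]) => [|o]; last by rewrite /= inE.
apply: (@sum_disjoint_intervals_le R _ (op_start S)).
- exact: bigmax_ge_id.
- by move=> o _; apply: op_length_gt0.
- by move=> o _; split; [apply: op_start_ge0 feas | apply: op_end_le_makespan].
- move=> o o' _ _ x; rewrite -!occupies_serverE; exact: server_capacity feas x o o'.
Qed.
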